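(* Let $$1\to(E,\imath_E)\overset{\mathrm{id}}{\to}(F,\imath_F)\overset{\psi}{\to}(G,\imath_G)\to1$$ be an exact sequence of (countably infinite) computable groups, where $E$ is a subgroup of $F$ and $\mathrm{id}$ denotes the inclusion map, such that $\mathrm{id}$ and $\psi$ are computable homomorphisms. Suppose that $([E_k,\mathcal{Q}_k])_{k\geq1}$ and $([G_m,\mathcal{S}_m])_{m\geq1}$ are computable normal Følner monotilings of the groups $(E,\imath_E)$ and $(G,\imath_G)$ respectively. Then there is a computable normal Følner monotiling $([F_l,\mathcal{R}_l])_{l\geq1}$ in the group $(F,\imath_F)$.
   Context: Conventions. All groups are discrete and countably infinite; $\mathrm{e}$ is the identity; $|\cdot|$ is cardinality; $\mathbb{N}=\{1,2,\dots\}$. Computability of functions on natural numbers is the usual notion (Turing computability). A subset of $\mathbb{N}$ is computable if its indicator function is computable. Computable spaces and groups. An indexing of a set $X$ is an injective map $\imath:X\to\mathbb{N}$ with $\imath(X)$ a computable subset of $\mathbb{N}$; $(X,\imath)$ is then a computable space. Functions between (products of) computable spaces are computable if the induced functions on indices are computable. A computable group is a pair $(\Gamma,\imath)$ of a group $\Gamma$ and an indexing $\imath$ such that multiplication $\Gamma\times\Gamma\to\Gamma$ is computable. A computable homomorphism is a group homomorphism between computable groups that is computable as a map of computable spaces. A sequence $(Z_n)_{n\ge1}$ of subsets of $\Gamma$ is computable if $(n,x)\mapsto\mathbf{1}_{Z_n}(x)$ is computable on $\mathbb{N}\times\Gamma$. A sequence $(F_n)_{n\ge1}$ of finite subsets is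 canonically computable if there is an algorithm that, given $n$, prints the finite set $\imath(F_n)$ and halts (equivalently, $n\mapsto\sum_{x\in \imath(F_n)}2^{x}$ is a total computable function). Følner monotilings. A sequence $(F_n)_{n\ge 1}$ of finite subsets of $\Gamma$ is a Følner sequence if for every finite $K\subseteq\Gamma$, $|\partial_K(F_n)|/|F_n|\to0$, where $\partial_K(F)=K^{-1}F\cap K^{-1}(\Gamma\setminus F)$ (equivalently, $|F_n\triangle gF_n|/|F_n|\to0$ for every $g\in\Gamma$). A monotiling $[F,\mathcal{Z}]$ of $\Gamma$ is a finite set $F\subseteq\Gamma$ (tile) together with a set $\mathcal{Z}\subseteq\Gamma$ (centers) such that $\{Fz:z\in\mathcal{Z}\}$ is a covering of $\Gamma$ by pairwise disjoint translates of $F$. A Følner monotiling is a sequence of monotilings $([F_n,\mathcal{Z}_n])_{n\ge1}$ with $(F_n)$ a Følner sequence. It is normal if $|F_n|/\log n\to\infty$ as $n\to\infty$ and $\mathrm{e}\in F_n$ for every $n$. It is computable if $(F_n)$ is canonically computable and $(\mathcal{Z}_n)$ is computable. *)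

(* Defs.v *)
From HB Require Import structures.
From mathcomp Require Import all_boot all_order all_algebra finmap.
From mathcomp Require Import all_classical all_reals all_analysis.

Set Implicit Arguments.
Unset Strict Implicit.
Unset Printing Implicit Defensive.

Import Order.TTheory GRing.Theory Num.Theory.
Import numFieldNormedType.Exports.

Local Open Scope classical_set_scope.

(* Turing computability, in Kleene's presentation by partial mu-recursive
   functions. The inputs are passed as a list; every rule only applies to
   input lists on which it is well-formed (e.g. a projection out of range or
   a search without result diverges). *)
Inductive recfun : Type :=
| RZero
| RSucc
| RProj of nat
| RComp of recfun & seq recfun
| RPrec of recfun & recfun
| RMin of recfun.

(* [rec_eval p xs y]: the program p halts on the inputs xs with output y. *)
Inductive rec_eval : recfun -> seq nat -> nat -> Prop :=
| EZero xs : rec_eval RZero xs 0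
| ESucc x : rec_eval RSucc [:: x] x.+1
| EProj i xs : i < size xs -> rec_eval (RProj i) xs (nth 0 xs i)
| EComp p qs xs ys z :
    size ys = size qs ->
    (forall i, i < size qs -> rec_eval (nth RZero qs i) xs (nth 0 ys i)) ->
    rec_eval p ys z ->
    rec_eval (RComp p qs) xs z
| EPrec0 p q xs z :
    rec_eval p xs z ->
    rec_eval (RPrec p q) (0 :: xs) z
| EPrecS p q n xs y z :
    rec_eval (RPrec p q) (n :: xs) y ->
    rec_eval q [:: n, y & xs] z ->
    rec_eval (RPrec p q) (n.+1 :: xs) z
| EMin p xs n (v : nat -> nat) :
    (forall i, i < n -> rec_eval p (i :: xs) (v i).+1) ->
    rec_eval p (n :: xs) 0 ->
    rec_eval (RMin p) xs n.

(* The map [args d |-> val d] is computable on its domain [range args]; for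
   maps induced on indices this domain is a computable set. *)
Definition computable {D : Type} (args : D -> seq nat) (val : D -> nat) : Prop :=
  exists p : recfun, forall d : D, rec_eval p (args d) (val d).

Definition computable_set (A : set nat) : Prop :=
  computable (fun n => [:: n]) (fun n => (n \in A : nat)).

(* The target {1, 2, ...} is the set of positive elements of [nat]. *)
Record indexing (X : Type) : Type := Indexing {
  index_of :> X -> nat;
  index_gt0 : forall x, 0 < index_of x;
  index_inj : injective index_of;
  index_range : computable_set (range index_of)
}.

Definition computable_map (X Y : Type) (i : indexing X) (j : indexing Y)
    (f : X -> Y) : Prop :=
  computable (fun x => [:: i x]) (fun x => j (f x)).

Definition computable_map2 (X Y Z : Type) (i : indexing X) (j : indexing Y)
    (k : indexing Z) (f : X -> Y -> Z) : Prop :=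
  computable (fun xy : X * Y => [:: i xy.1; j xy.2])
             (fun xy : X * Y => k (f xy.1 xy.2)).

Definition computable_group (T : groupType) (i : indexing T) : Prop :=
  computable_map2 i i i (fun x y : T => (x * y)%g).

(* Sequences are indexed by n >= 1: they are functions on [nat] whose value
   at 0 is ignored. *)
Definition computable_set_seq (T : Type) (i : indexing T) (Z : nat -> set T) :
    Prop :=
  computable (fun nx : nat * T => [:: nx.1.+1; i nx.2])
             (fun nx : nat * T => (nx.2 \in Z nx.1.+1 : nat)).

Definition canonically_computable (T : choiceType) (i : indexing T)
    (F : nat -> {fset T}) : Prop :=
  computable (fun n => [:: n.+1]) (fun n => \sum_(x <- F n.+1) 2 ^ i x).

Section Folner.
Variables (R : realType) (T : groupType).

Definition boundary (K F : {fset T}) : set T :=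
  [set (k^-1 * x)%g | k in [set` K] & x in [set` F]] `&`
  [set (k^-1 * x)%g | k in [set` K] & x in ~` [set` F]].

Definition Folner_seq (F : nat -> {fset T}) : Prop :=
  forall K : {fset T},
    (#|` fset_set (boundary K (F n))|%:R / #|` F n|%:R : R)%R
      @[n --> \oo] --> (0 : R)%R.

Definition translate (F : {fset T}) (z : T) : set T :=
  [set (x * z)%g | x in [set` F]].

Definition monotiling (F : {fset T}) (Z : set T) : Prop :=
  \bigcup_(z in Z) translate F z = setT /\ trivIset Z (translate F).

Definition Folner_monotiling (F : nat -> {fset T}) (Z : nat -> set T) : Prop :=
  (forall n, 0 < n -> monotiling (F n) (Z n)) /\ Folner_seq F.

Definition normal_seq (F : nat -> {fset T}) : Prop :=
  (#|` F n|%:R / ln n%:R : R)%R @[n --> \oo] --> +oo%R /\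
  (forall n, 0 < n -> (1%g : T) \in F n).

Definition computable_normal_Folner_monotiling (i : indexing T)
    (F : nat -> {fset T}) (Z : nat -> set T) : Prop :=
  [/\ Folner_monotiling F Z, normal_seq F,
      canonically_computable i F & computable_set_seq i Z].

End Folner.

(* Main.v *)
Require Import Defs.
From HB Require Import structures.
From mathcomp Require Import all_boot all_order all_algebra finmap.
From mathcomp Require Import all_classical all_reals all_analysis.

Set Implicit Arguments.
Unset Strict Implicit.
Unset Printing Implicit Defensive.

Import Order.TTheory GRing.Theory Num.Theory.
Import numFieldNormedType.Exports.

Local Open Scope classical_set_scope.

(** Choose a section [s] of [psi] with [s 1 = 1]. Every [x] of [F] is uniquely
[val (rho x) * s (psi x)] with [rho x] in [E]. If [A] tiles [G] with centers
[S] and [B] tiles [E] with centers [Q], then the set [tile A B] of the products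
[s g * val e], for [g] in [A] and [e] in [B], tiles [F]; its centers are the
[x] with [psi x] in [S] and [rho x] in [Q] ([tile_monotiling]).

Left translation by [f] sends [s g * val e] to
[s (psi f * g) * val (cocycle f g * e)]. A point of the tile therefore leaves
it only if [g] leaves [A] under [psi f] or [e] leaves [B] under [cocycle f g].
For a fixed finite set of elements [f], first choose [A] almost invariant under
the finitely many [psi f], then [B] almost invariant under the finitely many
[cocycle f g] with [g] in [A]: the resulting tile is almost invariant
([tile_invariant]). The family of all these tiles thus contains arbitrarily
large, arbitrarily invariant tiles, but in no particular order.

The order is repaired by search ([Folner_monotiling_diagonal]). Whether a
finite set is invariant up to the error [1 / l] under the elements of index
less than [l], and has at least [l ^ 2] elements, can be decided from its
canonical code, so the first member of the family with this property is a
computable function of [l]. The tiles found in this way form a Folner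
sequence, by construction, and it is normal because [l ^ 2 / ln l] tends to
infinity.

Invariance is measured by the integer [escape A g], the number of points of [A]
that left translation by [g] moves out of [A]; [Folner_seqP] translates the
definition by boundaries into this language. On the computability side, the
partial programs given by the hypotheses are first extended to total functions
on [nat] ([computable_extend]); all further constructions are then explicit
arithmetic expressions, or unbounded searches ([computable_search]). *)

(** * Programs for arithmetic *)

(** A composition has to list all the projections by which it passes its
context on, so the length of the context must be known. *)
Definition fixed_arity (D : Type) (args : D -> seq nat) : Prop :=
  exists n, forall d, size (args d) = n.

Lemma computable_ext (D : Type) (args : D -> seq nat) (f g : D -> nat) :
  f =1 g -> computable args f -> computable args g.
Proof. by move=> fg [p fP]; exists p => d; rewrite -fg; exact: fP. Qed.

(** The closure lemmas keep the domain [D] abstract: a function of several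
natural numbers, or of group elements given by their indices, is a function on
a product type whose components are listed by [args]. *)
Lemma computable_comp (D D' : Type) (args : D -> seq nat)
    (args' : D' -> seq nat) (val : D -> nat) (phi : D' -> D)
    (gs : seq (D' -> nat)) :
  (forall d', args (phi d') = [seq g d' | g <- gs]) ->
  (forall i, i < size gs -> computable args' (nth (fun=> 0) gs i)) ->
  computable args val -> computable args' (fun d' => val (phi d')).
Proof.
move=> argsE gsP [p valP].
have /choice[q qP] : forall i, exists r, i < size gs ->
    forall d', rec_eval r (args' d') (nth (fun=> 0) gs i d').
  move=> i; case: (ltnP i (size gs)) => [/gsP[r rP]|_]; first by exists r.
  by exists RZero.
exists (RComp p (mkseq q (size gs))) => d'.
apply: (EComp (ys := args (phi d'))); last exact: valP.
  by rewrite argsE size_map size_mkseq.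
rewrite size_mkseq => i ilt.
by rewrite nth_mkseq // argsE (nth_map (fun=> 0)) //; exact: qP.
Qed.

Lemma computable_nth (D : Type) (args : D -> seq nat) i :
  (forall d, i < size (args d)) -> computable args (fun d => nth 0 (args d) i).
Proof. by move=> ilt; exists (RProj i) => d; exact/EProj/ilt. Qed.

Lemma computable_reindex (D D' : Type) (args : D -> seq nat)
    (args' : D' -> seq nat) (val : D -> nat) (phi : D' -> D) (js : seq nat) :
  (forall d', all (fun j => j < size (args' d')) js) ->
  (forall d', args (phi d') = [seq nth 0 (args' d') j | j <- js]) ->
  computable args val -> computable args' (fun d' => val (phi d')).
Proof.
move=> jsP argsE; apply: (computable_comp
  (gs := [seq (fun d' => nth 0 (args' d') j) | j <- js])) => [d'|i].
  by rewrite -map_comp.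
rewrite size_map => ilt; rewrite (nth_map 0) //.
by apply: computable_nth => d'; exact: (all_nthP 0 (jsP d')).
Qed.

Lemma computable_comp1 (D D' : Type) (x : D -> nat) (args' : D' -> seq nat)
    (val : D -> nat) (phi : D' -> D) :
  computable (fun d => [:: x d]) val ->
  computable args' (fun d' => x (phi d')) ->
  computable args' (fun d' => val (phi d')).
Proof.
move=> + xP; apply: (computable_comp (gs := [:: fun d' => x (phi d')])) => //.
by case.
Qed.

Lemma computable_comp2 (D D' : Type) (x y : D -> nat) (args' : D' -> seq nat)
    (val : D -> nat) (phi : D' -> D) :
  computable (fun d => [:: x d; y d]) val ->
  computable args' (fun d' => x (phi d')) ->
  computable args' (fun d' => y (phi d')) ->
  computable args' (fun d' => val (phi d')).
Proof.
move=> + xP yP; apply: (computable_comp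
  (gs := [:: fun d' => x (phi d'); fun d' => y (phi d')])) => //.
by case=> [|[|]].
Qed.

Definition computable1 (f : nat -> nat) := computable (fun n => [:: n]) f.

Definition computable2 (f : nat -> nat -> nat) :=
  computable (fun n : nat * nat => [:: n.1; n.2]) (fun n => f n.1 n.2).

Lemma computable1_app D (args : D -> seq nat) (f : nat -> nat) (x : D -> nat) :
  computable1 f -> computable args x -> computable args (fun d => f (x d)).
Proof. exact: (computable_comp1 (phi := x)). Qed.

Lemma computable2_app D (args : D -> seq nat) (f : nat -> nat -> nat)
    (x y : D -> nat) :
  computable2 f -> computable args x -> computable args y ->
  computable args (fun d => f (x d) (y d)).
Proof. exact: (computable_comp2 (phi := fun d => (x d, y d))). Qed.

Lemma computableS D (args : D -> seq nat) (x : D -> nat) :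
  computable args x -> computable args (fun d => (x d).+1).
Proof. by apply: computable1_app; exists RSucc => n; exact: ESucc. Qed.

Lemma computable_cst D (args : D -> seq nat) (c : nat) :
  computable args (fun=> c).
Proof.
elim: c => [|c]; last exact: computableS.
by exists RZero => d; exact: EZero.
Qed.

(** Counter, accumulator, context: this is the order in which [RPrec] hands
the arguments to its step. *)
Lemma computable_iteri D (args : D -> seq nat) (b init : D -> nat)
    (step : D -> nat -> nat -> nat) :
  fixed_arity args -> computable args b -> computable args init ->
  computable (fun e : D * nat * nat => [:: e.1.2, e.2 & args e.1.1])
             (fun e => step e.1.1 e.1.2 e.2) ->
  computable args (fun d => iteri (b d) (step d) (init d)).
Proof.
move=> [n nP] bP [p pP] [q qP].
have main : computable (fun e : D * nat => e.2 :: args e.1)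
    (fun e => iteri e.2 (step e.1) (init e.1)).
  exists (RPrec p q) => -[d k] /=; elim: k => [|k IH].
    exact: EPrec0.
  by apply: EPrecS IH _; exact: (qP (d, k, _)).
apply: (computable_comp (phi := fun d => (d, b d)) _ _ main
  (gs := b :: [seq (fun d => nth 0 (args d) j) | j <- iota 0 n])) => [d|[|i]] //=.
  congr cons; rewrite -map_comp -[LHS](mkseq_nth 0) nP.
  by apply: eq_map.
rewrite size_map size_iota ltnS => ilt.
rewrite (nth_map 0) ?size_iota // nth_iota //.
by apply: computable_nth => d; rewrite nP.
Qed.

Ltac variable i :=
  lazymatch goal with |- computable ?args _ =>
    exact (@computable_nth _ args i (fun=> isT))
  end.

Ltac variables :=
  first [variable 0 | variable 1 | variable 2 | variable 3 | variable 4].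

Lemma computableD D (args : D -> seq nat) (x y : D -> nat) :
  computable args x -> computable args y ->
  computable args (fun d => x d + y d).
Proof.
apply: computable2_app.
apply: (@computable_ext _ _ (fun n => iteri n.1 (fun _ => succn) n.2)) => [n|].
  by elim: n.1 => //= m ->.
apply: computable_iteri => /=; [by exists 2|variables|variables|].
by apply: computableS; variables.
Qed.

Lemma computableM D (args : D -> seq nat) (x y : D -> nat) :
  computable args x -> computable args y ->
  computable args (fun d => x d * y d).
Proof.
apply: computable2_app.
apply: (@computable_ext _ _
  (fun n => iteri n.1 (fun _ acc => n.2 + acc) 0)) => [n|].
  by elim: n.1 => //= m ->.
apply: computable_iteri => /=; [by exists 2|variables|exact: computable_cst|].
by apply: computableD; variables.
Qed.

Lemma computable_exp D (args : D -> seq nat) (x y : D -> nat) :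
  computable args x -> computable args y ->
  computable args (fun d => x d ^ y d).
Proof.
apply: computable2_app.
apply: (@computable_ext _ _
  (fun n => iteri n.2 (fun _ acc => n.1 * acc) 1)) => [n|].
  by elim: n.2 => //= m ->; rewrite expnS.
apply: computable_iteri => /=; [by exists 2|variables|exact: computable_cst|].
by apply: computableM; variables.
Qed.

Lemma computable_pred D (args : D -> seq nat) (x : D -> nat) :
  computable args x -> computable args (fun d => (x d).-1).
Proof.
apply: computable1_app.
apply: (@computable_ext _ _ (fun n => iteri n (fun i _ => i) 0)); first by case.
apply: computable_iteri => /=; [by exists 1|variables|exact: computable_cst|].
by variables.
Qed.

Lemma computableB D (args : D -> seq nat) (x y : D -> nat) :
  computable args x -> computable args y ->
  computable args (fun d => x d - y d).
Proof.
apply: computable2_app.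
apply: (@computable_ext _ _
  (fun n => iteri n.2 (fun _ acc => acc.-1) n.1)) => [n|].
  by elim: n.2 => [|m /= ->]; rewrite ?subn0 ?subnS.
apply: computable_iteri => /=; [by exists 2|variables|variables|].
by apply: computable_pred; variables.
Qed.

Lemma computable_leq D (args : D -> seq nat) (x y : D -> nat) :
  computable args x -> computable args y ->
  computable args (fun d => (x d <= y d : nat)).
Proof.
move=> xP yP; apply: (@computable_ext _ _ (fun d => 1 - (x d - y d))) => [d|].
  by rewrite -subn_eq0; case: (x d - y d).
by do !apply: computableB => //; exact: computable_cst.
Qed.

Lemma computable_and D (args : D -> seq nat) (x y : D -> bool) :
  computable args (fun d => (x d : nat)) ->
  computable args (fun d => (y d : nat)) ->
  computable args (fun d => (x d && y d : nat)).
Proof.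
move=> xP yP; apply: (@computable_ext _ _ (fun d => x d * y d)) => [d|].
  by rewrite mulnb.
exact: computableM.
Qed.

Lemma computable_not D (args : D -> seq nat) (x : D -> bool) :
  computable args (fun d => (x d : nat)) ->
  computable args (fun d => (~~ x d : nat)).
Proof.
move=> xP; apply: (@computable_ext _ _ (fun d => 1 - x d)) => [d|].
  by case: (x d).
by apply: computableB => //; exact: computable_cst.
Qed.

Lemma computable_eq D (args : D -> seq nat) (x y : D -> nat) :
  computable args x -> computable args y ->
  computable args (fun d => (x d == y d : nat)).
Proof.
move=> xP yP.
apply: (@computable_ext _ _ (fun d => ((x d <= y d) && (y d <= x d) : nat))).
  by move=> d; rewrite eqn_leq.
by apply: computable_and; exact: computable_leq.
Qed.

(** The range is written [0 <= i < b d] so that [f] is applied to the bound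
variable itself, not to an ordinal coerced to [nat]; higher-order unification
can then find [f]. *)
Lemma computable_sum D (args : D -> seq nat) (b : D -> nat)
    (f : D -> nat -> nat) :
  fixed_arity args -> computable args b ->
  computable (fun e : D * nat => e.2 :: args e.1) (fun e => f e.1 e.2) ->
  computable args (fun d => \sum_(0 <= i < b d) f d i).
Proof.
move=> [n nP] bP fP; apply: (@computable_ext _ _
    (fun d => iteri (b d) (fun i acc => acc + f d i) 0)) => [d|].
  by elim: (b d) => [|m IH]; [rewrite big_geq|rewrite big_nat_recr //= IH].
apply: computable_iteri => //; [by exists n|exact: computable_cst|].
apply: computableD; first by variables.
(* The summand does not see the accumulator, which is entry 1. *)
apply: (computable_reindex (phi := fun e : D * nat * nat => (e.1.1, e.1.2))
  (js := 0 :: iota 2 n) _ _ fP) => e /=.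
  by apply/allP => j; rewrite mem_iota nP => /andP[].
congr cons; rewrite (iotaDl 2 0) -map_comp -[LHS](mkseq_nth 0) nP.
exact: eq_map.
Qed.

Lemma computable_divn D (args : D -> seq nat) (x y : D -> nat) :
  (forall d, 0 < y d) -> computable args x -> computable args y ->
  computable args (fun d => x d %/ y d).
Proof.
(* The quotient is the number of positive multiples of the divisor that do
   not exceed the dividend. *)
move=> y0 xP yP; pose quotient (n : nat * nat) :=
  \sum_(0 <= i < n.1) (i.+1 * n.2 <= n.1).
apply: (@computable_ext _ _ (fun d => quotient (x d, y d))) => [d|].
  rewrite /quotient big_mkord /=; under eq_bigr do rewrite -leq_divRL //.
  transitivity (\sum_(i < x d | i < x d %/ y d) 1).
    by rewrite [RHS]big_mkcond; apply: eq_bigr => i _; case: ltnP.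
  by rewrite -(big_ord_widen _ (fun=> 1) (leq_div _ _)) sum1_card card_ord.
apply: (computable2_app (f := fun m n => quotient (m, n))) => //.
rewrite /computable2 /quotient /=.
apply: computable_sum => /=; [by exists 2|variables|].
apply: computable_leq; last by variables.
by apply: computableM; [apply: computableS|]; variables.
Qed.

Lemma computable_odd D (args : D -> seq nat) (x : D -> nat) :
  computable args x -> computable args (fun d => (odd (x d) : nat)).
Proof.
move=> xP; apply: (@computable_ext _ _ (fun d => x d - x d %/ 2 * 2)) => [d|].
  by rewrite -modn2 {1}(divn_eq (x d) 2) addKn.
apply: computableB => //; apply: computableM; last exact: computable_cst.
by apply: computable_divn => //; exact: computable_cst.
Qed.

(** * Search and extension to total functions *)

(** Unbounded search; [test] only has to be computed on the domain [D], and a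
zero only has to exist for the points of [D]. *)
Lemma computable_search D (args : D -> seq nat) (test : D -> nat -> nat) :
  computable (fun e : D * nat => e.2 :: args e.1) (fun e => test e.1 e.2) ->
  (forall d, exists n, test d n = 0) ->
  exists mu : D -> nat, computable args mu /\ forall d, test d (mu d) = 0.
Proof.
move=> [p pP] ex0; have ex d : exists n, test d n == 0.
  by have [n /eqP] := ex0 d; exists n.
exists (fun d => ex_minn (ex d)); split; last first.
  by move=> d; case: ex_minnP => n /eqP.
exists (RMin p) => d; case: ex_minnP => n /eqP n0 nmin.
apply: (EMin (v := fun i => (test d i).-1)) => [i ilt|]; last first.
  by rewrite -n0; exact: (pP (d, n)).
rewrite prednK; first exact: (pP (d, i)).
by rewrite lt0n; apply: contraTN ilt => /nmin; rewrite -leqNgt.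
Qed.

(** A partial program whose domain is decidable extends to a total one. The
evaluation of a composition is strict, so a conditional cannot be obtained by
computing both branches; primitive recursion over the truth value [dom d'] runs
its step, and with it the partial program, only if this value is [1]. *)
Lemma computable_extend (D D' : Type) (args : D -> seq nat)
    (args' : D' -> seq nat) (val : D -> nat) (dom : D' -> bool) :
  injective args -> fixed_arity args' ->
  (forall d', dom d' -> exists d, args d = args' d') ->
  computable args val -> computable args' (fun d' => (dom d' : nat)) ->
  exists2 ext : D' -> nat, computable args' ext &
    forall d d', args d = args' d' -> dom d' -> ext d' = val d.
Proof.
move=> args_inj [n nP] domP [p pP] chiP.
have /choice[ext extP] : forall d', exists m, rec_eval
    (RPrec RZero (RComp p [seq RProj j.+2 | j <- iota 0 n]))
    (nat_of_bool (dom d') :: args' d') m /\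
    (forall d, args d = args' d' -> dom d' -> m = val d).
  move=> d'; case: (boolP (dom d')) => [/domP[d dE]|_]; last first.
    by exists 0; split=> //; apply: EPrec0; exact: EZero.
  exists (val d); split=> [|e eE _]; last first.
    by congr val; apply: args_inj; rewrite dE.
  apply: (EPrecS (y := 0)); first by apply: EPrec0; exact: EZero.
  apply: (EComp (ys := args' d')); last by rewrite -dE.
    by rewrite nP size_map size_iota.
  rewrite size_map size_iota => i ilt.
  rewrite (nth_map 0) ?size_iota // nth_iota //.
  by apply: (@EProj i.+2) => /=; rewrite nP !ltnS.
exists ext; last by move=> d d'; have [] := extP d'; auto.
have main : computable (fun d' => (dom d' : nat) :: args' d') ext.
  by eexists => d'; have [] := extP d'; eauto.
apply: (computable_comp (phi := id) _ _ main (gs := (fun d' => (dom d' : nat)) ::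
    [seq (fun d' => nth 0 (args' d') j) | j <- iota 0 n])) => [d|[|i]] //=.
  congr cons; rewrite -map_comp -[LHS](mkseq_nth 0) nP.
  exact: eq_map.
rewrite size_map size_iota ltnS => ilt.
rewrite (nth_map 0) ?size_iota // nth_iota //.
by apply: computable_nth => d; rewrite nP.
Qed.

(** * Canonical codes of finite sets *)

(** The binary digit of [t] at position [a]; for the code [t] of a finite set
this is membership of the element of index [a]. *)
Definition digit (t a : nat) : bool := odd (t %/ 2 ^ a).

Lemma computable_digit D (args : D -> seq nat) (t a : D -> nat) :
  computable args t -> computable args a ->
  computable args (fun d => (digit (t d) (a d) : nat)).
Proof.
move=> tP aP; rewrite /digit; apply: computable_odd; apply: computable_divn => //.
- by move=> d; rewrite expn_gt0.
- by apply: computable_exp => //; exact: computable_cst.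
Qed.

(** Proves computability by following the shape of the expression; hypotheses
[computable1 f] and [computable2 f] serve as closure rules for [f]. *)
Ltac computability :=
  lazymatch goal with
  | |- fixed_arity _ => solve [eexists=> ? /=; reflexivity]
  | |- computable1 _ => rewrite /computable1 /=; computability
  | |- computable2 _ => rewrite /computable2 /=; computability
  | |- computable _ (fun d => _ + _) => apply: computableD; computability
  | |- computable _ (fun d => _ - _) => apply: computableB; computability
  | |- computable _ (fun d => _ * _) => apply: computableM; computability
  | |- computable _ (fun d => _ ^ _) => apply: computable_exp; computability
  | |- computable _ (fun d => _ %/ _) =>
      apply: computable_divn; [by move=> ? | computability | computability]
  | |- computable _ (fun d => bigop _ _ _) =>
      apply: computable_sum => /=; computability
  | |- computable _ (fun d => nat_of_bool (_ <= _)) =>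
      apply: computable_leq; computability
  | |- computable _ (fun d => nat_of_bool (_ == _)) =>
      apply: computable_eq; computability
  | |- computable _ (fun d => nat_of_bool (_ && _)) =>
      apply: computable_and; computability
  | |- computable _ (fun d => nat_of_bool (~~ _)) =>
      apply: computable_not; computability
  | |- computable _ (fun d => nat_of_bool (odd _)) =>
      apply: computable_odd; computability
  | |- computable _ (fun d => nat_of_bool (digit _ _)) =>
      apply: computable_digit; computability
  | |- computable ?args ?val =>
      first
      [ assumption
      | variables
      | exact: computable_cst
      | lazymatch val with fun d => S _ => apply: computableS; computability end
      | match goal with
        | H : computable1 _ |- _ => apply: (computable1_app H); computability
        | H : computable2 _ |- _ => apply: (computable2_app H); computability
        end ]
  end.

(** Induction on the length: halving the sum drops the digit at position [0] and
shifts all the others. *)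
Lemma digit_sum (chi : nat -> bool) N a :
  digit (\sum_(0 <= i < N) chi i * 2 ^ i) a = (a < N) && chi a.
Proof.
elim: N chi a => [|N IH] chi a.
  by rewrite big_geq // /digit div0n.
rewrite big_nat_recl //= expn0 muln1.
under eq_bigr do rewrite expnS mulnCA.
rewrite -big_distrr /=; case: a => [|a].
  by rewrite /digit divn1 oddD mul2n odd_double addbF oddb.
rewrite /digit expnS divnMA [2 * _]mulnC divnDMl //.
rewrite (divn_small (m := chi 0)) ?add0n; last by case: (chi 0).
exact: (IH (fun i => chi i.+1)).
Qed.

Lemma sum_indicator (s : seq nat) (h : nat -> nat) N :
  uniq s -> {in s, forall a, a < N} ->
  \sum_(0 <= a < N) (a \in s) * h a = \sum_(a <- s) h a.
Proof.
move=> s_uniq sN.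
under eq_bigr do rewrite mulnC.
rewrite [RHS](perm_big [seq a <- index_iota 0 N | a \in s]) /=; last first.
  apply: uniq_perm => // [|a]; first exact/filter_uniq/iota_uniq.
  rewrite mem_filter mem_index_iota /=.
  by case: (boolP (a \in s)) => //= /sN ->.
rewrite big_filter [RHS]big_mkcond /=.
by apply: eq_bigr => a _; case: ifP; rewrite ?muln1 ?muln0.
Qed.

Section Code.
Variables (X : choiceType) (i : indexing X).
Implicit Type A : {fset X}.

Definition code A := \sum_(x <- A) 2 ^ i x.

Let indices A := [seq i x | x <- A].

Let indices_uniq A : uniq (indices A).
Proof. rewrite map_inj_uniq ?fset_uniq //; exact: Defs.index_inj. Qed.

Let indices_bound A : {in indices A, forall a, a < code A}.
Proof.
move=> _ /mapP[x xA ->]; rewrite /code (big_fsetD1 x) //=.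
by apply: leq_trans (ltn_expl _ _) (leq_addr _ _).
Qed.

Lemma digit_code A a : digit (code A) a = (a \in [seq i x | x <- A]).
Proof.
rewrite {1}/code -(big_map i predT (fun a => 2 ^ a)).
rewrite -(sum_indicator _ (indices_uniq A) (indices_bound (A := A))).
rewrite digit_sum; case: (boolP (a \in _)); last by rewrite andbF.
by move=> /indices_bound ->.
Qed.

Lemma digit_code_index A x : digit (code A) (i x) = (x \in A).
Proof. by rewrite digit_code mem_map //; exact: Defs.index_inj. Qed.

(** A sum over a finite set becomes a bounded sum over the digits of its code:
this is how a program inspects the set. The code itself bounds the indices,
since [a < 2 ^ a]. *)
Lemma sum_code A (h : nat -> nat) :
  \sum_(0 <= a < code A) digit (code A) a * h a = \sum_(x <- A) h (i x).
Proof.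
under eq_bigr do rewrite digit_code.
by rewrite (sum_indicator _ (indices_uniq A) (indices_bound (A := A))) big_map.
Qed.

End Code.

(** * Computable maps between indexed sets *)

Lemma computable_range (X : Type) (i : indexing X) :
  computable1 (fun n => (n \in range i : nat)).
Proof. exact: index_range. Qed.

Lemma index_in_range (X : Type) (i : indexing X) x : i x \in range i.
Proof. by rewrite inE /=; exists x. Qed.

(** Uniformization: a decidable relation that relates every point of [D] to
some element of [X] contains the graph of a computable map. *)
Lemma computable_choice (D X : Type) (args : D -> seq nat) (i : indexing X)
    (test : D -> nat -> bool) :
  computable (fun e : D * nat => e.2 :: args e.1)
             (fun e => (test e.1 e.2 : nat)) ->
  (forall d, exists x, test d (i x)) ->
  exists f : D -> X, computable args (fun d => i (f d)) /\
    forall d, test d (i (f d)).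
Proof.
move=> testP ex; have inP := computable_range i.
have [||mu [muP mu0]] := @computable_search D args
    (fun d n => ~~ ((n \in range i) && test d n)).
- apply: computable_not; apply: computable_and => //.
  by apply: (computable1_app inP); variables.
- move=> d; have [x dx] := ex d; exists (i x).
  by rewrite index_in_range dx.
have /choice[f fP] : forall d, exists x, i x = mu d.
  move=> d; have : mu d \in range i by have := mu0 d; case: (_ \in _).
  by rewrite inE /= => -[x _ <-]; exists x.
exists f; split=> [|d]; first by apply: computable_ext muP => d; rewrite fP.
by rewrite fP; have := mu0 d; case: (test _ _); rewrite ?andbF.
Qed.

Lemma computable_map_total (X Y : Type) (i : indexing X) (j : indexing Y) f :
  computable_map i j f ->
  exists2 g, computable1 g & forall x, g (i x) = j (f x).
Proof.
move=> fP; have [] := @computable_extend X nat (fun x => [:: i x])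
    (fun n => [:: n]) (fun x => j (f x)) (fun n => n \in range i).
- by move=> x y [xy]; apply: (@Defs.index_inj _ i).
- by computability.
- by move=> n; rewrite inE /= => -[x _ <-]; exists x.
- exact: fP.
- exact: computable_range.
by move=> g gP gE; exists g => // x; apply: gE => //; exact: index_in_range.
Qed.

Lemma computable_map2_total (X Y Z : Type) (i : indexing X) (j : indexing Y)
    (k : indexing Z) f :
  computable_map2 i j k f ->
  exists2 g, computable2 g & forall x y, g (i x) (j y) = k (f x y).
Proof.
move=> fP; have [] := @computable_extend (X * Y) (nat * nat)
    (fun xy => [:: i xy.1; j xy.2]) (fun n => [:: n.1; n.2])
    (fun xy => k (f xy.1 xy.2))
    (fun n => (n.1 \in range i) && (n.2 \in range j)).
- move=> [x y] [x' y'] /= [xx' yy'].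
  by congr pair; [apply: (@Defs.index_inj _ i)|apply: (@Defs.index_inj _ j)].
- by computability.
- move=> [m n] /= /andP[]; rewrite !inE /= => -[x _ <-] [y _ <-].
  by exists (x, y).
- exact: fP.
- have iP := computable_range i; have jP := computable_range j.
  apply: computable_and.
    by apply: (computable1_app iP); computability.
  by apply: (computable1_app jP); computability.
move=> g gP gE; exists (fun m n => g (m, n)).
  by apply: computable_ext gP; case.
by move=> x y; apply: (gE (x, y) (i x, j y)) => //=; rewrite !index_in_range.
Qed.

(** * Invariance of finite sets *)

Section Escape.
Variables (R : realType) (T : groupType).
Implicit Types (A K : {fset T}) (g : T).

(** Counting the points that leave [A] avoids the real-valued ratios of the
definition of a Folner sequence and can be computed from the code of [A]. *)
Definition escape A g : nat := \sum_(x <- A) ((g * x)%g \notin A).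

Lemma escapeE A g : escape A g = size [seq x <- A | (g * x)%g \notin A].
Proof.
rewrite size_filter -sum1_count big_mkcond /=.
by apply: eq_bigr => x _; case: (_ \notin _).
Qed.

Lemma finite_boundary K A : finite_set (boundary K A).
Proof.
apply: (sub_finite_set (B := [set (k^-1 * x)%g | k in [set` K] & x in [set` A]])).
  by move=> x [].
exact: finite_image2.
Qed.

(** With [K = {1, g}], a point [x] of [A] such that [g * x] is outside [A] is in
the boundary. *)
Lemma escape_boundary A g :
  escape A g <= #|` fset_set (boundary [fset 1; g]%g%fset A)|.
Proof.
rewrite escapeE; apply: uniq_leq_size; first exact/filter_uniq/fset_uniq.
move=> x; rewrite mem_filter => /andP[gxA xA].
rewrite in_fset_set ?inE; last exact: finite_boundary.
split.
  exists 1%g; first by rewrite /= !inE eqxx.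
  by exists x => //; rewrite invg1 mul1g.
exists g; first by rewrite /= !inE eqxx orbT.
by exists (g * x)%g => /=; [apply/negP|rewrite mulKg].
Qed.

(** A boundary point [y] comes with [k] and [h] in [K] such that [x = k * y] is in
[A] and [h * y] is not: so [x] leaves [A] under [h * k^-1]. *)
Lemma boundary_escape K A :
  #|` fset_set (boundary K A)| <=
  \sum_(k <- K) \sum_(h <- K) escape A (h * k^-1)%g.
Proof.
pose L := flatten [seq flatten [seq [seq (k^-1 * x)%g |
  x <- A & (h * k^-1 * x)%g \notin A] | h <- K] | k <- K].
have -> : (\sum_(k <- K) \sum_(h <- K) escape A (h * k^-1)%g = size L)%N.
  rewrite size_flatten sumnE /shape !big_map; apply: eq_bigr => k _.
  rewrite size_flatten sumnE /shape !big_map; apply: eq_bigr => h _.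
  by rewrite escapeE size_map.
apply: uniq_leq_size; first exact: fset_uniq.
move=> y; rewrite in_fset_set ?inE; last exact: finite_boundary.
case=> -[k kK [x xA kxy]] [h hK [z zA hzy]].
apply/flatten_mapP; exists k => //; apply/flatten_mapP; exists h => //.
apply/mapP; exists x => //; rewrite mem_filter xA andbT.
by apply/negP; rewrite -mulgA kxy -hzy mulVKg.
Qed.

Lemma eventually_all (I : eqType) (s : seq I) (P : I -> nat -> Prop) :
  (forall x, x \in s -> \forall n \near \oo, P x n) ->
  \forall n \near \oo, forall x, x \in s -> P x n.
Proof.
elim: s => [|x s IH] sP; first by near=> n.
have Px := sP x (mem_head _ _).
have Ps : \forall n \near \oo, forall y, y \in s -> P y n.
  by apply: IH => y ys; apply: sP; rewrite in_cons ys orbT.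
near=> n => y; rewrite in_cons => /predU1P[->|]; first by near: n.
by move: y; near: n.
Unshelve. all: end_near. Qed.

Lemma Folner_seqP (A_ : nat -> {fset T}) :
  Folner_seq R A_ <->
  (forall g N, \forall n \near \oo, N * escape (A_ n) g <= #|` A_ n|).
Proof.
split=> [A_Folner g N|inv K].
  have /cvgrPdist_lt/(_ (N.+1%:R^-1)%R) := A_Folner [fset 1; g]%g%fset.
  rewrite invr_gt0 ltr0n => /(_ isT) near_small; near=> n.
  have [->|A0] := eqVneq (A_ n) fset0.
    by rewrite /escape big_seq_fset0 muln0.
  rewrite -(ler_nat R).
  have : (`|0 - #|` fset_set (boundary [fset 1; g]%g%fset (A_ n))|%:R /
      #|` A_ n|%:R| < N.+1%:R^-1 :> R)%R by near: n.
  rewrite sub0r normrN ger0_norm ?divr_ge0 //.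
  rewrite ltr_pdivrMr ?ltr0n ?cardfs_gt0 // mulrC ltr_pdivlMr ?ltr0n //.
  move=> /ltW; apply: le_trans; rewrite -natrM ler_nat mulnC.
  by apply: leq_mul => //; exact: escape_boundary.
apply/cvgrPdist_le => e e0.
(* By [boundary_escape] the boundary is at most [#|K| ^ 2] times as large as
   the largest escape, which must thus be below [e / #|K| ^ 2] in proportion. *)
have [N Ne] : exists N, ((#|` K| * #|` K|)%:R <= N.+1%:R * e)%R.
  exists (Num.trunc ((#|` K| * #|` K|)%:R / e : R)%R).
  by rewrite -ler_pdivrMr //; apply/ltW/truncnS_gt.
have near_inv : \forall n \near \oo, forall k, k \in (K : seq T) ->
    forall h, h \in (K : seq T) ->
    N.+1 * escape (A_ n) (h * k^-1)%g <= #|` A_ n|.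
  by do 2!apply: eventually_all => ? _; exact: inv.
near=> n.
rewrite sub0r normrN ger0_norm ?divr_ge0 //.
have [->|A0] := eqVneq (A_ n) fset0.
  by rewrite cardfs0 invr0 mulr0 ltW.
rewrite ler_pdivrMr ?ltr0n ?cardfs_gt0 //.
rewrite -(ler_pM2l (x := N.+1%:R)) ?ltr0n // mulrA.
apply: (@le_trans _ _ ((#|` K| * #|` K|)%:R * #|` A_ n|%:R)%R); last first.
  by rewrite ler_wpM2r.
rewrite -!natrM ler_nat.
apply: leq_trans (leq_mul (leqnn _) (boundary_escape _ _)) _.
rewrite big_distrr /= -mulnA -[X in _ <= X * _]sum1_size big_distrl /=.
rewrite 2!big_seq; apply: leq_sum => k kK; rewrite mul1n.
rewrite big_distrr /= -[X in _ <= X * _]sum1_size big_distrl /=.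
rewrite 2!big_seq; apply: leq_sum => h hK; rewrite mul1n.
by move: k kK h hK; near: n.
Unshelve. all: end_near. Qed.

End Escape.

(** Since [ln n >= 1] eventually, a sequence that outgrows [ln n] is unbounded. *)
Lemma normal_seq_card (R : realType) (T : groupType) (A_ : nat -> {fset T}) N :
  normal_seq R A_ -> \forall n \near \oo, N <= #|` A_ n|.
Proof.
case=> /cvgryPge/(_ N%:R)%R near_ge _.
near=> n; have n0 : (0 < n%:R :> R)%R.
  by rewrite ltr0n; near: n; exact: nbhs_infty_gt.
have ln_ge1 : (1 <= ln n%:R :> R)%R.
  rewrite -[leLHS]expRK ler_ln ?posrE ?expR_gt0 //.
  by near: n; exact: nbhs_infty_ger.
have : (N%:R <= #|` A_ n|%:R / ln n%:R :> R)%R by near: n.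
rewrite ler_pdivlMr; last exact: lt_le_trans ln_ge1.
rewrite -(ler_nat R); apply: le_trans.
by rewrite -[leLHS]mulr1 ler_wpM2l.
Unshelve. all: end_near. Qed.

(** * Extraction of a Folner sequence by search *)

Section Diagonal.
Variables (R : realType) (T : groupType) (i : indexing T).
Hypothesis mul_computable : computable_group i.

(** Large invariant sets are recognized from their codes: with truncated
subtraction, each inequality [m <= n] is the vanishing of [m - n], so a
conjunction of inequalities is the vanishing of a sum. *)
Lemma computable_invariance : exists2 bad : nat -> nat -> nat, computable2 bad &
  forall l A, bad l (code i A) = 0 <->
    l * l <= #|` A| /\ forall x, i x < l -> l * escape A x <= #|` A|.
Proof.
have [mul mulP mulE] := computable_map2_total mul_computable.
have inP := computable_range i.
pose size_ c := \sum_(0 <= a < c) digit c a * 1.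
pose escape_ c j := \sum_(0 <= a < c) digit c a * ~~ digit c (mul j a).
pose bad l c := (l * l - size_ c) +
  \sum_(0 <= j < l) (j \in range i) * (l * escape_ c j - size_ c).
have sizeP : computable1 size_.
  rewrite /computable1 /size_; apply: computable_sum => /=; [computability..|].
  by apply: computableM; [apply: computable_digit|]; computability.
have escapeP : computable2 escape_.
  rewrite /computable2 /escape_.
  apply: computable_sum => /=; [computability..|].
  apply: computableM; [|apply: computable_not]; apply: computable_digit;
  by computability.
have badP : computable2 bad.
  rewrite /computable2 /bad; apply: computableD.
    by computability.
  apply: computable_sum => /=; [computability..|].
  apply: computableM; last by computability.
  by apply: (computable1_app inP); computability.
exists bad => // l A.
have -> : bad l (code i A) = (l * l - #|` A|) +
    \sum_(0 <= j < l) (j \in range i) * (l * escape_ (code i A) j - #|` A|).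
  by rewrite /bad /size_ (sum_code i A (fun=> 1)) sum1_size.
have escE x : escape_ (code i A) (i x) = escape A x.
  rewrite /escape_ (sum_code i A (fun a => ~~ digit _ (mul _ a))).
  by apply: eq_bigr => y _; rewrite mulE digit_code_index.
split.
  move/eqP; rewrite addn_eq0 subn_eq0 => /andP[llA bad0]; split=> // x xl.
  move: bad0; rewrite big_mkord sum_nat_eq0 => /forallP/(_ (Ordinal xl)) /=.
  by rewrite muln_eq0 escE index_in_range /= subn_eq0.
case=> llA small; apply/eqP; rewrite addn_eq0 subn_eq0 llA /=.
rewrite big_nat_cond big1 // => j; rewrite andbT => /= jl.
case: (boolP (j \in range i)) => //; rewrite inE /= => -[x _ xj].
by rewrite mul1n; apply/eqP; rewrite subn_eq0 -xj escE; apply: small; rewrite xj.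
Qed.

(** The search bounds the proportion of escaping points by [1 / l] and the size of
the tile below by [l ^ 2]; the first bound makes the tiles a Folner sequence, the
second makes it normal. *)
Lemma Folner_monotiling_diagonal (T_ : nat -> {fset T}) (Z_ : nat -> set T) :
  canonically_computable i T_ -> computable_set_seq i Z_ ->
  (forall n, 0 < n -> monotiling (T_ n) (Z_ n)) ->
  (forall n, 0 < n -> 1%g \in T_ n) ->
  (forall (K : {fset T}) N, exists n, N <= #|` T_ n.+1| /\
     forall x, x \in K -> N * escape (T_ n.+1) x <= #|` T_ n.+1|) ->
  exists F_ R_, computable_normal_Folner_monotiling R i F_ R_.
Proof.
move=> TP ZP T_tiling T_one T_inv.
have [bad badP badE] := computable_invariance.
have codeP : computable1 (fun n => code i (T_ n.+1)).
  by apply: (computable_comp1 (phi := id) TP); computability.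
have [|l|p [pP p0]] := @computable_search nat (fun l => [:: l])
    (fun l n => bad l (code i (T_ n.+1))).
- by computability.
- pose K := fset_set [set x | i x < l].
  have inK x : i x < l -> x \in K.
    move=> xl; rewrite in_fset_set ?inE //=.
    apply: (@finite_preimage _ _ (`I_l) i); last exact: finite_II.
    by move=> y z _ _; exact: Defs.index_inj.
  (* With [l * l] for both bounds the invariance is better than the search asks
     for, since [l <= l * l]. *)
  have [n [nl small]] := T_inv K (l * l); exists n; apply/badE; split=> // x xl.
  apply: leq_trans (small x (inK x xl)); apply: leq_mul => //.
  by rewrite leq_pmull // (leq_ltn_trans _ xl).
have {}pP : computable1 p := pP.
have p_inv l : l * l <= #|` T_ (p l).+1| /\
    forall x, i x < l -> l * escape (T_ (p l).+1) x <= #|` T_ (p l).+1|.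
  exact/badE/p0.
exists (fun l => T_ (p l).+1), (fun l => Z_ (p l).+1); split.
- split=> [n _|]; first exact: T_tiling.
  apply/Folner_seqP => g N; near=> l; have [_ /(_ g) gl] := p_inv l.
  apply: leq_trans (gl _); last by near: l; exact: nbhs_infty_gt.
  by apply: leq_mul => //; near: l; exact: nbhs_infty_ge.
- split=> [|n _]; last exact: T_one.
  apply: (ger_cvgy (f := fun n => n%:R)%R); last exact: cvgr_idn.
  near=> l; have l1 : 1 < l by near: l; exact: nbhs_infty_gt.
  have l0 : (0 < l%:R :> R)%R by rewrite ltr0n ltnW.
  rewrite ler_pdivlMr; last by rewrite ln_gt0 // ltr1n.
  apply: (@le_trans _ _ (l%:R * l%:R)%R).
    by rewrite ler_wpM2l // ltW // ln_sublinear.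
  by rewrite -natrM ler_nat; have [] := p_inv l.
- apply: (computable_comp1 (phi := fun n => p n.+1) TP).
  by computability.
- apply: (computable_comp2 (phi := fun nx => (p nx.1.+1, nx.2)) ZP) => /=.
    by computability.
  by variables.
Unshelve. all: end_near. Qed.
End Diagonal.

(** * Tiles of a group extension *)

Section Extension.
Variables (F G : groupType) (P : {pred F}) (E : subGroupType P).
Variable psi : {multiplicative F -> G}.
Hypothesis exact_F : forall x : F, x \in P <-> psi x = 1%g.
Variable s : G -> F.
Hypothesis sK : cancel s psi.
Hypothesis s1 : s 1%g = 1%g.
Variable rho : F -> E.
Hypothesis rhoE : forall x, (val (rho x) * s (psi x))%g = x.

Definition tile (A : {fset G}) (B : {fset E}) : {fset F} :=
  [fset (s g * val e)%g | g in A, e in B]%fset.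

Definition centers (S : set G) (Q : set E) : set F :=
  [set x | S (psi x) /\ Q (rho x)].

(* The structure carried by [psi] only records that products are preserved. *)
Let psiV : {morph psi : x / x^-1 >-> x^-1}%g.
Proof.
have psi1 : psi 1%g = 1%g by apply: (mulgI (psi 1%g)); rewrite -gmulfM !mulg1.
by move=> x; apply/divg1_eq; rewrite invgK -gmulfM mulVg.
Qed.

Lemma psi_val (e : E) : psi (val e) = 1%g.
Proof. exact/exact_F/valP. Qed.

Lemma rho_ker x : psi x = 1%g -> val (rho x) = x.
Proof. by move=> x1; rewrite -{2}(rhoE x) x1 s1 mulg1. Qed.

Lemma psi_mul_section (e : E) y : psi (val e * s y)%g = y.
Proof. by rewrite gmulfM psi_val sK mul1g. Qed.

Lemma rho_mul_section (e : E) y : rho (val e * s y)%g = e.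
Proof.
apply: val_inj; apply: (mulIg (s y)).
by rewrite -{2}(psi_mul_section e y) rhoE.
Qed.

Lemma section_mul_inj : injective (fun ge : G * E => s ge.1 * val ge.2)%g.
Proof.
move=> [g e] [g' e'] /= eq_ge.
have gg' : g = g'.
  by have := congr1 psi eq_ge; rewrite !gmulfM !psi_val !sK !mulg1.
by move: eq_ge; rewrite gg' => /mulgI/val_inj ->.
Qed.

Lemma sum_tile (A : {fset G}) (B : {fset E}) (h : F -> nat) :
  \sum_(x <- tile A B) h x = \sum_(g <- A) \sum_(e <- B) h (s g * val e)%g.
Proof.
rewrite -(big_allpairs_dep (h := fun g e => (s g * val e)%g)).
apply: perm_big; apply: uniq_perm; first exact: fset_uniq.
  apply: allpairs_uniq; rewrite ?fset_uniq // => -[g e] [g' e'] _ _.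
  by move=> eq_ge; apply: section_mul_inj.
move=> x; apply/imfset2P/allpairsP => [[g gA [e eB ->]]|[[g e] [gA eB ->]]].
  by exists (g, e).
by exists g => //; exists e.
Qed.

Lemma card_tile A B : #|` tile A B| = #|` A| * #|` B|.
Proof.
rewrite -sum1_size sum_tile -sum1_size big_distrl /=.
by apply: eq_bigr => g _; rewrite sum1_size mul1n.
Qed.

(** Decompose [x] as [s g * val e * z]: the tiling of [G] gives [g] and [psi z]
from [psi x]; the kernel element that is then left over, between [s g] and
[s (psi z)], gives [e] and [rho z] by the tiling of [E]. *)
Lemma tile_monotiling A S B Q :
  monotiling A S -> monotiling B Q -> monotiling (tile A B) (centers S Q).
Proof.
move=> [A_cover A_triv] [B_cover B_triv]; split.
  rewrite -subTset => x _.
  have : setT (psi x) by [].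
  rewrite -A_cover => -[z Sz [g gA gz]].
  pose y := ((s g)^-1 * x * (s z)^-1)%g.
  have y1 : psi y = 1%g by rewrite /y !gmulfM !psiV !sK -gz mulKg mulgV.
  have : setT (rho y) by [].
  rewrite -B_cover => -[q Qq [e eB eq_y]].
  exists (val q * s z)%g.
    by split; rewrite ?psi_mul_section ?rho_mul_section.
  exists (s g * val e)%g; first by apply: in_imfset2.
  rewrite -mulgA (mulgA (val e)) -valM eq_y rho_ker // /y.
  by rewrite mulgVK mulVKg.
move=> z z' [Sz Qz] [Sz' Qz'] [x [[_ /imfset2P[g gA [e eB ->]] xz]
  [_ /imfset2P[g' gA' [e' eB' ->]] xz']]].
have psi_x (g1 : G) (e1 : E) z1 : psi (s g1 * val e1 * z1)%g = (g1 * psi z1)%g.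
  by rewrite !gmulfM psi_val sK mulg1.
have zz' : psi z = psi z'.
  apply: A_triv => //; exists (psi x); split.
    by exists g; rewrite // -xz psi_x.
  by exists g'; rewrite // -xz' psi_x.
have gg' : g = g'.
  by apply: (mulIg (psi z)); rewrite -(psi_x _ e) xz zz' -xz' psi_x.
have rr' : (e * rho z = e' * rho z')%g.
  apply: val_inj; rewrite !valM; apply: (mulIg (s (psi z))).
  rewrite -!mulgA {2}zz' !rhoE; apply: (mulgI (s g)).
  by rewrite mulgA xz gg' mulgA xz'.
have -> : z = (val (rho z) * s (psi z))%g by rewrite rhoE.
rewrite -[RHS]rhoE -zz'; congr (val _ * _)%g.
apply: B_triv => //; exists (e * rho z)%g; split; first by exists e.
by exists e' => //; rewrite -rr'.
Qed.

(** The argument of [rho] is in the kernel of [psi]; so [cocycle f g] is the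
element of [E] by which [s] fails to commute with the left action of [f]. *)
Definition cocycle f g : E := rho ((s (psi f * g))^-1 * f * s g)%g.

Lemma cocycleE f g : (f * s g = s (psi f * g) * val (cocycle f g))%g.
Proof.
rewrite rho_ker; last by rewrite !gmulfM !psiV !sK -mulgA mulVg.
by rewrite -mulgA mulVKg.
Qed.

(** By [cocycleE], [f * (s g * val e)] is [s (psi f * g) * val (cocycle f g * e)],
which is in the tile as soon as [psi f * g] is in [A] and [cocycle f g * e] is in
[B]. *)
Lemma escape_tile A B f :
  escape (tile A B) f <=
  escape A (psi f) * #|` B| + \sum_(g <- A) escape B (cocycle f g).
Proof.
rewrite /escape sum_tile big_distrl -big_split /=.
apply: leq_sum => g _; rewrite -sum1_size big_distrr -big_split /=.
apply: leq_sum => e _; rewrite muln1.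
have [gA|] := boolP ((psi f * g)%g \in A); last by case: (_ \notin _).
have [eB|] := boolP ((cocycle f g * e)%g \in B); last by case: (_ \notin _).
suff -> : (f * (s g * val e))%g \in tile A B by [].
by rewrite mulgA cocycleE -mulgA -valM; exact: in_imfset2.
Qed.

(** The two terms of [escape_tile] each use up half of the allowed proportion,
whence the factor [2]. *)
Lemma tile_invariant A B f N :
  2 * N * escape A (psi f) <= #|` A| ->
  (forall g, g \in A -> 2 * N * escape B (cocycle f g) <= #|` B|) ->
  N * escape (tile A B) f <= #|` tile A B|.
Proof.
move=> Af Bf; rewrite -(@leq_pmul2l 2) // mulnA card_tile.
apply: leq_trans (leq_mul (leqnn _) (escape_tile _ _ _)) _.
rewrite mulnDr mulnA [leqRHS]mul2n -addnn; apply: leq_add; first exact: leq_mul.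
rewrite big_distrr /= -[in leqRHS]sum1_size big_distrl /=.
by rewrite !big_seq; apply: leq_sum => g gA; rewrite mul1n; exact: Bf.
Qed.

End Extension.

(** * Computability of the extension *)

Section ComputableExtension.
Variables (F G : groupType) (P : {pred F}) (E : subGroupType P).
Variables (iE : indexing E) (iF : indexing F) (iG : indexing G).
Variable psi : {multiplicative F -> G}.
Hypothesis F_computable : computable_group iF.
Hypothesis id_computable : computable_map iE iF (fun x : E => val x).
Hypothesis psi_computable : computable_map iF iG psi.
Hypothesis exact_F : forall x : F, x \in P <-> psi x = 1%g.

(** Search for a preimage, then divide by the one found for [1] so that [1] is
lifted to [1] and the tiles contain the identity. *)
Lemma computable_section : (forall y : G, exists x : F, psi x = y) ->
  exists s : G -> F, [/\ computable_map iG iF s, cancel s psi & s 1%g = 1%g].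
Proof.
move=> psi_surj.
have [psi_ psiP psiE] := computable_map_total psi_computable.
have [mul mulP mulE] := computable_map2_total F_computable.
have [||s0 [s0P s0E]] := @computable_choice G F (fun y => [:: iG y]) iF
    (fun y b => psi_ b == iG y).
- by computability.
- by move=> y; have [x <-] := psi_surj y; exists x; rewrite psiE.
have {}s0E y : psi (s0 y) = y.
  by apply: (@Defs.index_inj _ iG); have /eqP := s0E y; rewrite psiE.
exists (fun y => s0 y * (s0 1)^-1)%g; split; last by rewrite mulgV.
- apply: (@computable_ext _ _ (fun y => mul (iF (s0 y)) (iF (s0 1)^-1)%g)).
    by move=> y; rewrite mulE.
  by computability.
- move=> y; apply: (mulIg (psi (s0 1)))%g.
  by rewrite -gmulfM mulgVK !s0E mulg1.
Qed.

(** Searching for [rho x] in [E] avoids computing inverses, and it inverts the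
inclusion of [E] at the same time. *)
Lemma computable_remainder (s : G -> F) :
  computable_map iG iF s -> cancel s psi ->
  exists rho : F -> E, computable_map iF iE rho /\
    forall x, (val (rho x) * s (psi x))%g = x.
Proof.
move=> sP sK.
have [psi_ psiP psiE] := computable_map_total psi_computable.
have [mul mulP mulE] := computable_map2_total F_computable.
have [s_ s_P sE] := computable_map_total sP.
have [j jP jE] := computable_map_total id_computable.
have [||rho [rhoP rhoE]] := @computable_choice F E (fun x => [:: iF x]) iE
    (fun x b => mul (j b) (s_ (psi_ (iF x))) == iF x).
- by computability.
- move=> x; have ker : (x * (s (psi x))^-1)%g \in P.
    apply/exact_F; apply: (mulIg (psi x)).
    by rewrite -{2}[psi x]sK -gmulfM mulgVK mul1g.
  exists (@Sub F P E _ ker); apply/eqP.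
  by rewrite psiE sE jE mulE SubK mulgVK.
exists rho; split=> // x; apply: (@Defs.index_inj _ iF).
by have /eqP := rhoE x; rewrite psiE sE jE mulE.
Qed.

Variables (s : G -> F) (rho : F -> E).
Hypothesis s_computable : computable_map iG iF s.
Hypothesis rho_computable : computable_map iF iE rho.
Hypothesis sK : cancel s psi.

(** The products [s g * val e] are pairwise distinct, so the code of the tile is
the sum of [2 ^ i] over their indices [i]. *)
Lemma computable_tile (A_ : nat -> {fset G}) (B_ : nat -> {fset E}) r :
  computable1 r ->
  canonically_computable iG A_ -> canonically_computable iE B_ ->
  canonically_computable iF (fun n => tile s (A_ (r n).+1) (B_ n)).
Proof.
move=> rP AP BP.
have [mul mulP mulE] := computable_map2_total F_computable.
have [s_ s_P sE] := computable_map_total s_computable.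
have [j jP jE] := computable_map_total id_computable.
have codeA : computable1 (fun m => code iG (A_ m.+1)).
  by apply: (computable_comp1 (phi := id) AP); computability.
have codeB : computable (fun n => [:: n.+1]) (fun n => code iE (B_ n.+1)).
  exact: BP.
pose tile_code cA cB := \sum_(0 <= a < cA) digit cA a *
  \sum_(0 <= b < cB) digit cB b * 2 ^ mul (s_ a) (j b).
have tile_codeP : computable2 tile_code.
  rewrite /computable2 /tile_code.
  apply: computable_sum => /=; [computability..|].
  apply: computableM; first by apply: computable_digit; computability.
  apply: computable_sum => /=; [computability..|].
  apply: computableM; first by apply: computable_digit; computability.
  by computability.
apply: (@computable_ext _ _ (fun n =>
    tile_code (code iG (A_ (r n.+1).+1)) (code iE (B_ n.+1)))) => [n|].
  rewrite (sum_tile exact_F sK) /tile_code (sum_code iG _ (fun a =>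
    \sum_(0 <= b < _) digit _ b * 2 ^ mul (s_ a) (j b))).
  apply: eq_bigr => g _; rewrite (sum_code iE _ (fun b => 2 ^ mul _ (j b))).
  by apply: eq_bigr => e _; rewrite sE jE mulE.
by computability.
Qed.

Lemma computable_centers (S_ : nat -> set G) (Q_ : nat -> set E) r :
  computable1 r -> computable_set_seq iG S_ -> computable_set_seq iE Q_ ->
  computable_set_seq iF (fun n => centers psi rho (S_ (r n).+1) (Q_ n)).
Proof.
move=> rP SP QP.
apply: (@computable_ext _ _ (fun nx : nat * F =>
  ((psi nx.2 \in S_ (r nx.1.+1).+1) && (rho nx.2 \in Q_ nx.1.+1) : nat))).
  by move=> [n x] /=; congr nat_of_bool; apply/andP/idP; rewrite !inE.
apply: computable_and.
  apply: (computable_comp2 (phi := fun nx => (r nx.1.+1, psi nx.2)) SP) => /=.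
    by computability.
  by apply: (computable_comp1 (phi := snd) psi_computable); variables.
apply: (computable_comp2 (phi := fun nx => (nx.1, rho nx.2)) QP) => /=.
  by variables.
by apply: (computable_comp1 (phi := snd) rho_computable); variables.
Qed.
End ComputableExtension.

(** The 2-adic valuation serves to list pairs: since each value is taken at
arbitrarily large arguments, [n |-> (logn 2 n, n)] meets, for each [m], pairs
[(m, n)] with [n] as large as required. *)
Lemma computable_logn2 : computable1 (logn 2).
Proof.
apply: (@computable_ext _ _ (fun n => \sum_(0 <= k < n.-1)
    (n %/ 2 ^ k.+1 * 2 ^ k.+1 == n))) => [n|].
  rewrite logn_count_dvd // big_add1.
  by apply: eq_bigr => k _; rewrite dvdn_eq.
apply: computable_sum => /=; first by computability.
  by apply: computable_pred; variables.
apply: computable_eq; last by variables.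
apply: computableM; last by computability.
by apply: computable_divn => [e||]; [rewrite expn_gt0|computability..].
Qed.

Theorem theorem2p11 (R : realType) (F G : groupType) (P : {pred F})
    (E : subGroupType P)
    (iE : indexing E) (iF : indexing F) (iG : indexing G)
    (psi : {multiplicative F -> G})
    (E_infinite : infinite_set [set: E])
    (F_infinite : infinite_set [set: F])
    (G_infinite : infinite_set [set: G])
    (E_computable : computable_group iE)
    (F_computable : computable_group iF)
    (G_computable : computable_group iG)
    (id_computable : computable_map iE iF (fun x : E => val x))
    (psi_computable : computable_map iF iG psi)
    (exact_F : forall x : F, x \in P <-> psi x = 1%g)
    (exact_G : forall y : G, exists x : F, psi x = y)
    (E_ : nat -> {fset E}) (Q_ : nat -> set E)
    (G_ : nat -> {fset G}) (S_ : nat -> set G)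
    (E_monotiling : computable_normal_Folner_monotiling R iE E_ Q_)
    (G_monotiling : computable_normal_Folner_monotiling R iG G_ S_) :
  exists (F_ : nat -> {fset F}) (R_ : nat -> set F),
    computable_normal_Folner_monotiling R iF F_ R_.
Proof.
have [[E_tiling /Folner_seqP E_inv] [_ E_one] E_code Q_comp] := E_monotiling.
have [[G_tiling /Folner_seqP G_inv] G_normal G_code S_comp] := G_monotiling.
have [_ G_one] := G_normal.
have [s [s_comp sK s1]] :=
  computable_section F_computable psi_computable exact_G.
have [rho [rho_comp rhoE]] := computable_remainder F_computable id_computable
  psi_computable exact_F s_comp sK.
apply: (Folner_monotiling_diagonal R F_computable
  (T_ := fun n => tile s (G_ (logn 2 n).+1) (E_ n))
  (Z_ := fun n => centers psi rho (S_ (logn 2 n).+1) (Q_ n))).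
- exact: (computable_tile F_computable id_computable exact_F s_comp sK
    computable_logn2).
- exact: (computable_centers psi_computable rho_comp computable_logn2).
- move=> n n0; apply: (tile_monotiling exact_F sK s1 rhoE).
    exact: G_tiling.
  exact: E_tiling.
- move=> n n0; rewrite -[1%g]mulg1 -{1}s1 -(val1 E).
  by apply: in_imfset2; [apply: G_one|apply: E_one].
move=> K N.
have [m [Gm_card Gm_inv]] : exists m, N <= #|` G_ m.+1| /\
    forall f, f \in (K : seq F) ->
      2 * N * escape (G_ m.+1) (psi f) <= #|` G_ m.+1|.
  have [m _ mP] : \forall m \near \oo, N <= #|` G_ m| /\
      forall f, f \in (K : seq F) -> 2 * N * escape (G_ m) (psi f) <= #|` G_ m|.
    apply: filterI; first exact: normal_seq_card G_normal.
    by apply: eventually_all => f _; exact: G_inv.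
  by exists m; exact: (mP m.+1 (leqnSn m)).
have [k _ kP] : \forall k \near \oo, forall f, f \in (K : seq F) ->
    forall g, g \in (G_ m.+1 : seq G) ->
    2 * N * escape (E_ k) (cocycle psi s rho f g) <= #|` E_ k|.
  by do 2!apply: eventually_all => ? _; exact: E_inv.
(* An [n] with valuation exactly [m], so that the tile of [G] is the one already
   chosen, and at least [k], so that the tile of [E] is invariant enough. *)
pose n := (2 ^ m * (2 * k).+1)%N.
have n0 : 0 < n by rewrite muln_gt0 expn_gt0.
have kn : k <= n.
  apply: leq_trans (leq_pmull _ _); rewrite ?expn_gt0 //.
  by rewrite ltnW // ltnS leq_pmull.
have nm : logn 2 n = m.
  rewrite lognM ?expn_gt0 // pfactorK // logn_coprime ?addn0 //.
  by rewrite coprime2n /= mul2n odd_double.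
exists n.-1; rewrite prednK // nm; split.
  rewrite (card_tile exact_F sK) (leq_trans Gm_card) // leq_pmulr //.
  by rewrite cardfs_gt0; apply/fset0Pn; exists 1%g; exact: E_one.
move=> f fK; apply: (tile_invariant exact_F sK s1 rhoE); first exact: Gm_inv.
by move=> g gG; exact: kP.
Qed.
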